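(* Let $(\boldsymbol{L};\boldsymbol{V})$ be any nonnegative pair, with $\boldsymbol{L}\in\mathbb{R}^{n\times n}$ and $\boldsymbol{V}\in\mathbb{R}^{n\times p}$, and let $\mathcal{X}$ be an extended L-ensemble based on $(\boldsymbol{L};\boldsymbol{V})$. Let $\boldsymbol{Q}\in\mathbb{R}^{n\times p}$ be an orthonormal basis of $\operatorname{span}\boldsymbol{V}$ and $\widetilde{\boldsymbol{L}}=(\boldsymbol{I}-\boldsymbol{Q}\boldsymbol{Q}^\top)\boldsymbol{L}(\boldsymbol{I}-\boldsymbol{Q}\boldsymbol{Q}^\top)$. Then $\mathcal{X}$ is a DPP with marginal kernel $$\boldsymbol{K}=\boldsymbol{Q}\boldsymbol{Q}^\top+\widetilde{\boldsymbol{L}}(\boldsymbol{I}+\widetilde{\boldsymbol{L}})^{-1}.$$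
   Context: The ground set $\Omega$ has $n$ elements and is identified with $\{1,\dots,n\}$. For a matrix $\boldsymbol{M}$ and $X\subseteq\Omega$, $\boldsymbol{M}_X$ is the submatrix with rows and columns in $X$ and $\boldsymbol{M}_{X,:}$ the submatrix of rows in $X$. Determinantal point process (DPP): for a symmetric matrix $\boldsymbol{K}\in\mathbb{R}^{n\times n}$ with $\boldsymbol{0}\preceq\boldsymbol{K}\preceq\boldsymbol{I}$ (a marginal kernel), a random subset $\mathcal{X}\subseteq\Omega$ is a DPP with marginal kernel $\boldsymbol{K}$ if $\mathbf{P}(A\subseteq\mathcal{X})=\det\boldsymbol{K}_A$ for all $A\subseteq\Omega$, with $\det\boldsymbol{K}_\varnothing=1$. Nonnegative pair (NNP): a pair $(\boldsymbol{L};\boldsymbol{V})$ with $\boldsymbol{L}\in\mathbb{R}^{n\times n}$ symmetric, $\boldsymbol{V}\in\mathbb{R}^{n\times p}$ of full column rank, $0\le p\le n$, such that $\boldsymbol{L}$ is conditionally positive semi-definite with respect to $\boldsymbol{V}$, i.e. $\boldsymbol{x}^\top\boldsymbol{L}\boldsymbol{x}\ge 0$ for every $\boldsymbol{x}\in\mathbb{R}^n$ with $\boldsymbol{V}^\top\boldsymbol{x}=0$. (If $p=0$, $\boldsymbol{V}$ and $\boldsymbol{Q}$ are empty, $\boldsymbol{Q}\boldsymbol{Q}^\top=0$ and $\widetilde{\boldsymbol{L}}=\boldsymbol{L}$.) Extended L-ensemble based on the NNP $(\boldsymbol{L};\boldsymbol{V})$: a random subset $\mathcal{X}\subseteq\Omega$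 with $$\forall X\subseteq\Omega,\quad \mathbf{P}(\mathcal{X}=X)\propto(-1)^p\det\begin{pmatrix}\boldsymbol{L}_X&\boldsymbol{V}_{X,:}\\(\boldsymbol{V}_{X,:})^\top&\boldsymbol{0}\end{pmatrix}$$ (the determinant of the empty matrix is $1$). *)

(* Defs.v *)
From HB Require Import structures.
From mathcomp Require Import all_boot all_order all_algebra.
From mathcomp Require Import all_classical all_reals all_analysis.
Set Implicit Arguments.
Unset Strict Implicit.
Unset Printing Implicit Defensive.
Import Order.TTheory GRing.Theory Num.Theory.
Local Open Scope classical_set_scope.
Local Open Scope ring_scope.

Section Matrices.
Context {R : realType}.

(* Rows and columns indexed by S are listed in increasing order. *)
Definition principal_submx n (M : 'M[R]_n) (S : {set 'I_n}) : 'M[R]_#|S| :=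
  mxsub (@enum_val _ (mem S)) (@enum_val _ (mem S)) M.

Definition rows_submx n p (M : 'M[R]_(n, p)) (S : {set 'I_n}) :
    'M[R]_(#|S|, p) :=
  rowsub (@enum_val _ (mem S)) M.

Definition qform n (M : 'M[R]_n) (x : 'cV[R]_n) : R := (x^T *m M *m x) 0 0.

Definition psdmx n (M : 'M[R]_n) : Prop :=
  M^T = M /\ forall x : 'cV[R]_n, 0 <= qform M x.

Definition loewner_le n (A B : 'M[R]_n) : Prop := psdmx (B - A).

Definition cond_psdmx n p (L : 'M[R]_n) (V : 'M[R]_(n, p)) : Prop :=
  forall x : 'cV[R]_n, V^T *m x = 0 -> 0 <= qform L x.

Definition nonnegative_pair n p (L : 'M[R]_n) (V : 'M[R]_(n, p)) : Prop :=
  [/\ (p <= n)%N, L^T = L, \rank V = p & cond_psdmx L V].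

Definition marginal_kernel n (K : 'M[R]_n) : Prop :=
  [/\ K^T = K, loewner_le 0 K & loewner_le K 1%:M].

(* MathComp's %MS relations compare row spaces, whence the transpositions:
   the columns of Q are orthonormal and span the column space of V. *)
Definition orthonormal_basis_of n p (Q V : 'M[R]_(n, p)) : Prop :=
  Q^T *m Q = 1%:M /\ (Q^T == V^T)%MS.

Definition bordered_submx n p (L : 'M[R]_n) (V : 'M[R]_(n, p))
    (S : {set 'I_n}) : 'M[R]_(#|S| + p) :=
  block_mx (principal_submx L S) (rows_submx V S) (rows_submx V S)^T 0.

Definition projected_kernel n p (L : 'M[R]_n) (Q : 'M[R]_(n, p)) : 'M[R]_n :=
  (1%:M - Q *m Q^T) *m L *m (1%:M - Q *m Q^T).

End Matrices.

Section RandomSubsets.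
Context {R : realType} {d : measure_display} {T : measurableType d}.

(* Measurability with respect to the discrete sigma-algebra on {set 'I_n}. *)
Definition random_subset n (X : T -> {set 'I_n}) : Prop :=
  forall S : {set 'I_n}, measurable [set w | X w = S].

Definition is_dpp (P : probability T R) n (X : T -> {set 'I_n})
    (K : 'M[R]_n) : Prop :=
  [/\ random_subset X, marginal_kernel K &
      forall A : {set 'I_n},
        P [set w | A \subset X w] = (\det (principal_submx K A))%:E].

(* The proportionality constant c is not required to be positive: this is
   forced, since the probabilities sum to 1 and, for a nonnegative pair, the
   signed determinants are nonnegative. *)
Definition is_extended_L_ensemble (P : probability T R) n p
    (X : T -> {set 'I_n}) (L : 'M[R]_n) (V : 'M[R]_(n, p)) : Prop :=
  random_subset X /\
  exists c : R, forall S : {set 'I_n},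
    P [set w | X w = S] = (c * ((-1) ^+ p * \det (bordered_submx L V S)))%:E.

End RandomSubsets.

(* Main.v *)
Require Import Defs.
From HB Require Import structures.
From mathcomp Require Import all_boot all_order all_algebra.
From mathcomp Require Import all_classical all_reals all_analysis.
Set Implicit Arguments.
Unset Strict Implicit.
Unset Printing Implicit Defensive.
Import Order.TTheory GRing.Theory Num.Theory.
Local Open Scope classical_set_scope.
Local Open Scope ring_scope.

(** Write N for the bordered matrix with blocks I + L, V, V^T, 0, and N_A for
    the same matrix with the diagonal entries of I kept only at the indices
    outside A.

    The determinant of N_A is multilinear in its first n rows, each of which
    is a row of (L, V) plus, off A, a unit vector. Expanding it gives the sum,
    over all S containing A, of the bordered determinants that define the
    extended L-ensemble (sum_det_bordered_submx). Hence the probability that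
    the random set contains A is proportional to det N_A, with the same
    constant for every A; since A = set0 has probability 1, it is
    det N_A / det N, and in particular det N is not zero.

    On the other side, N_A = N - diag(1_A, 0). If G satisfies V^T G = 0 and
    (I + L) G + V H = I for some H, so that (G; H) is the first block column
    of N^-1, then N_A = N (I - (G; H) diag(1_A) (I, 0)), and Sylvester's
    identity det(I + AB) = det(I + BA) turns the determinant of the second
    factor into det (I - G)_A (det_bordered_kernel). So the random set is a
    DPP with kernel I - G.

    It remains to see that G = I - K for the announced K. With Lt the
    projected kernel, I - K = (I + Lt)^-1 - Q Q^T; this is killed by Q^T,
    hence by V^T, and (I + Lt) (I - K) = I - Q Q^T says that
    I - (I + L) (I - K) has its columns in the span of V, which provides H
    (bordered_sub1_kernel). Conditional positivity of L makes Lt positive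
    semidefinite, so that I + Lt is invertible and K and I - K are sums of
    congruences of positive semidefinite matrices
    (marginal_kernel_projected). *)

(** * Determinants of compressions *)

Section Determinants.
Variable R : comNzRingType.

(** Sylvester's identity: the matrix with blocks 1, - A, B, 1 has two
    block-triangular factorizations, one for each side. *)
Lemma det_1D_mulmxC m n (A : 'M[R]_(m, n)) (B : 'M[R]_(n, m)) :
  \det (1%:M + A *m B) = \det (1%:M + B *m A).
Proof.
pose lo : 'M[R]_(m + n) := block_mx 1%:M 0 B 1%:M.
have E1 : \det (block_mx (1%:M + A *m B) (- A) 0 1%:M *m lo) =
    \det (lo *m block_mx 1%:M (- A) 0 (1%:M + B *m A)).
  congr (\det _); rewrite !mulmx_block !(mul1mx, mulmx1, mul0mx, mulmx0).
  by rewrite !mulNmx !mulmxN !(addr0, add0r) addrK [1%:M + _ *m _]addrC addKr.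
by move: E1; rewrite !det_mulmx !det_ublock !det_lblock !det1 !(mulr1, mul1r).
Qed.

(** When F selects the coordinates in a set, F^T F is the projection onto them
    and the matrix on the right is M with the other rows replaced by those of
    the identity. It has the size of M whatever k is, so that compressions to
    different sets can be added up inside a single determinant. *)
Lemma det_compression k m (F : 'M[R]_(k, m)) (M : 'M[R]_m) :
  F *m F^T = 1%:M ->
  \det (F *m M *m F^T) = \det (F^T *m F *m M + (1%:M - F^T *m F)).
Proof.
move=> FF.
have -> : F *m M *m F^T = 1%:M + (F *m M - F) *m F^T.
  by rewrite mulmxBl FF addrC subrK.
rewrite det_1D_mulmxC mulmxBr mulmxA; congr (\det _).
exact: addrCA.
Qed.

Definition ind_mx n (A : {set 'I_n}) : 'M[R]_n :=
  diag_mx (\row_i (i \in A)%:R).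

Lemma mul_ind_mxE n k (A : {set 'I_n}) (M : 'M[R]_(n, k)) i j :
  (ind_mx A *m M) i j = if i \in A then M i j else 0.
Proof. by rewrite mul_diag_mx !mxE; case: ifP; rewrite ?mul1r ?mul0r. Qed.

Lemma ind_mxE n (A : {set 'I_n}) i j :
  ind_mx A i j = if i \in A then (1%:M : 'M[R]_n) i j else 0.
Proof. by rewrite -[ind_mx A]mulmx1 mul_ind_mxE. Qed.

Lemma ind_mxC n (A : {set 'I_n}) : ind_mx (~: A) = 1%:M - ind_mx A.
Proof.
apply/matrixP=> i j; rewrite !mxE inE.
by case: (i \in A) => /=; rewrite ?mul0rn ?subrr ?subr0.
Qed.

(** Multilinearity of the determinant in its first n rows: in the Leibniz
    formula, each product of n sums is distributed over the choices of a
    summand in every row, and S is the set of rows where U is chosen. *)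
Lemma det_col_mx_rowD n p (U W : 'M[R]_(n, n + p)) (Z : 'M[R]_(p, n + p)) :
  \det (col_mx (U + W) Z) =
  \sum_(S : {set 'I_n}) \det (col_mx (ind_mx S *m U + ind_mx (~: S) *m W) Z).
Proof.
rewrite /determinant exchange_big /=; apply: eq_bigr => s _.
rewrite -mulr_sumr; congr (_ * _); rewrite big_split_ord /=.
under [X in X * _]eq_bigr => i _ do rewrite col_mxEu mxE.
rewrite bigA_distr mulr_suml; apply: eq_bigr => S _.
rewrite big_split_ord /=; congr (_ * _); last first.
  by apply: eq_bigr => i _; rewrite !col_mxEd.
apply: eq_bigr => i _; rewrite col_mxEu [RHS]mxE !mul_ind_mxE inE.
by case: (i \in S); rewrite /= ?addr0 ?add0r.
Qed.

Definition sel_mx n (S : {set 'I_n}) : 'M[R]_(#|S|, n) :=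
  rowsub (@enum_val _ (mem S)) 1%:M.

Lemma sel_mx_mul_tr n (S : {set 'I_n}) : sel_mx S *m (sel_mx S)^T = 1%:M.
Proof.
rewrite /sel_mx mul_rowsub_mx mul1mx; apply/matrixP => i j; rewrite !mxE.
by rewrite (inj_eq enum_val_inj) eq_sym.
Qed.

Lemma tr_sel_mx_mul n (S : {set 'I_n}) : (sel_mx S)^T *m sel_mx S = ind_mx S.
Proof.
apply/matrixP => i j; rewrite ind_mxE !mxE.
under eq_bigr => k _ do rewrite !mxE.
case: ifPn => iS.
  rewrite (bigD1 (enum_rank_in iS i)) //= enum_rankK_in // eqxx mul1r.
  rewrite big1 ?addr0 // => k; rewrite -(inj_eq enum_val_inj) enum_rankK_in //.
  by move/negbTE=> ->; rewrite mul0r.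
rewrite big1 // => k _; case: eqP => [E|_]; last by rewrite mul0r.
by case/negP: iS; rewrite -E enum_valP.
Qed.

End Determinants.

Arguments ind_mx {R n}.
Arguments sel_mx {R n}.

(** * Sums of bordered minors *)

Section Submatrices.
Variable R : realType.

Lemma principal_submxE n (M : 'M[R]_n) (S : {set 'I_n}) :
  principal_submx M S = sel_mx S *m M *m (sel_mx S)^T.
Proof.
by rewrite /principal_submx -{1}[M]mulmx1 mxsub_mul rowsubE trmx_mxsub trmx1.
Qed.

(** Sylvester's identity applied to the product of G sel^T and sel, which is
    G diag(1_A). *)
Lemma det_principal_submx n (G : 'M[R]_n) (A : {set 'I_n}) :
  \det (principal_submx (1%:M - G) A) = \det (1%:M - G *m ind_mx A).
Proof.
rewrite principal_submxE mulmxBr mulmx1 mulmxBl sel_mx_mul_tr -mulmxA -mulmxN.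
by rewrite det_1D_mulmxC mulNmx -mulmxA tr_sel_mx_mul.
Qed.

Lemma det_bordered_submx n p (L : 'M[R]_n) (V : 'M[R]_(n, p)) (S : {set 'I_n}) :
  \det (bordered_submx L V S) =
  \det (col_mx (ind_mx S *m row_mx L V + ind_mx (~: S) *m row_mx 1%:M 0)
               (row_mx V^T 0)).
Proof.
pose F : 'M[R]_(#|S| + p, n + p) := block_mx (sel_mx S) 0 0 1%:M.
have FF : F *m F^T = 1%:M.
  rewrite tr_block_mx mulmx_block !trmx0 trmx1 sel_mx_mul_tr.
  by rewrite !(mulmx0, mul0mx, mulmx1, addr0, add0r) -scalar_mx_block.
have -> : bordered_submx L V S = F *m block_mx L V V^T 0 *m F^T.
  rewrite tr_block_mx !mulmx_block !trmx0 trmx1.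
  rewrite !(mulmx0, mul0mx, mulmx1, mul1mx, addr0, add0r).
  rewrite /bordered_submx principal_submxE /rows_submx rowsubE.
  by rewrite -/(sel_mx S) trmx_mul.
rewrite det_compression //; congr (\det _).
rewrite tr_block_mx !mulmx_block !trmx0 trmx1 tr_sel_mx_mul.
rewrite !(mulmx0, mul0mx, mulmx1, mul1mx, addr0, add0r).
rewrite (scalar_mx_block n p 1) opp_block_mx !add_block_mx !mul_mx_row.
by rewrite add_row_mx mulmx0 mulmx1 !subrr !addr0 ind_mxC.
Qed.

(** In the multilinear expansion of the right-hand side, a choice S of rows of
    (L, V) which misses some index of A leaves a zero row there; if S contains
    A, the other rows are those of the identity, as in det_bordered_submx. *)
Lemma sum_det_bordered_submx n p (L : 'M[R]_n) (V : 'M[R]_(n, p))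
    (A : {set 'I_n}) :
  \sum_(S : {set 'I_n} | A \subset S) \det (bordered_submx L V S) =
  \det (block_mx (L + ind_mx (~: A)) V V^T 0).
Proof.
have -> : block_mx (L + ind_mx (~: A)) V V^T 0 =
    col_mx (row_mx L V + ind_mx (~: A) *m row_mx 1%:M 0) (row_mx V^T 0).
  by rewrite mul_mx_row mulmx1 mulmx0 add_row_mx addr0.
rewrite det_col_mx_rowD [RHS](bigID (fun S : {set 'I_n} => A \subset S)) /=.
rewrite [X in _ + X]big1 ?addr0 => [|S /subsetPn[i iA iS]]; last first.
  rewrite (expand_det_row _ (lshift p i)) big1 // => j _.
  rewrite col_mxEu mxE !mul_ind_mxE !inE (negbTE iS) iA /=.
  by rewrite addr0 mul0r.
apply: eq_bigr => S sAS; rewrite det_bordered_submx.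
congr (\det (col_mx (_ + _) _)); apply/matrixP => i j.
rewrite !mul_ind_mxE !inE.
by case: ifP => // iS; rewrite (contra (fintype.subsetP sAS i) iS).
Qed.

(** The hypotheses say that the bordered matrix maps (G; H) to (I; 0), so that
    it can be factored out of its perturbation by diag(1_A, 0). *)
Lemma det_bordered_kernel n p (L G : 'M[R]_n) (V : 'M[R]_(n, p))
    (H : 'M[R]_(p, n)) (A : {set 'I_n}) :
  V^T *m G = 0 -> (1%:M + L) *m G + V *m H = 1%:M ->
  \det (block_mx (L + ind_mx (~: A)) V V^T 0) =
  \det (block_mx (L + 1%:M) V V^T 0) * \det (principal_submx (1%:M - G) A).
Proof.
move=> VG LG; rewrite det_principal_submx.
have -> : \det (1%:M - G *m ind_mx A) =
    \det (block_mx (1%:M - G *m ind_mx A) 0 (- (H *m ind_mx A)) 1%:M).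
  by rewrite det_lblock det1 mulr1.
rewrite -det_mulmx mulmx_block; congr (\det _).
rewrite !(mulmx0, mul0mx, mulmx1, mul1mx, addr0, add0r).
rewrite mulmxN [V^T *m _]mulmxBr [V^T *m (G *m _)]mulmxA VG mul0mx subr0 mulmx1.
congr block_mx; rewrite mulmxBr mulmx1 !mulmxA -addrA -opprD -mulmxDl.
by rewrite (addrC L 1%:M) LG mul1mx ind_mxC addrA [L + _]addrC.
Qed.

End Submatrices.

(** * Positive semidefinite matrices *)

Section PositiveSemidefinite.
Variable R : realType.

Lemma psdmx1 n : psdmx (1%:M : 'M[R]_n).
Proof.
split=> [|x]; first exact: trmx1.
rewrite /qform mulmx1 mxE; apply: sumr_ge0 => i _.
by rewrite mxE -expr2 sqr_ge0.
Qed.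

Lemma psdmxD n (A B : 'M[R]_n) : psdmx A -> psdmx B -> psdmx (A + B).
Proof.
move=> [sA pA] [sB pB]; split=> [|x]; first by rewrite linearD /= sA sB.
by rewrite /qform mulmxDr mulmxDl mxE addr_ge0 ?pA ?pB.
Qed.

Lemma psdmx_congr n m (A : 'M[R]_n) (B : 'M[R]_(n, m)) :
  psdmx A -> psdmx (B^T *m A *m B).
Proof.
move=> [sA pA]; split=> [|x]; first by rewrite !trmx_mul trmxK sA mulmxA.
by have := pA (B *m x); rewrite /qform trmx_mul !mulmxA.
Qed.

Lemma psdmx_gram n m (B : 'M[R]_(n, m)) : psdmx (B^T *m B).
Proof. by rewrite -[B^T]mulmx1; apply: psdmx_congr; exact: psdmx1. Qed.

(** A vector v in the kernel of 1 + A satisfies |v|^2 + v A v^T = 0, a sum of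
    two nonnegative terms. *)
Lemma psdmx_unit1D n (A : 'M[R]_n) : psdmx A -> 1%:M + A \in unitmx.
Proof.
move=> [_ pA]; rewrite unitmxE unitfE; apply/negP => /det0P[v v0 vA].
case/negP: v0; apply/eqP.
have q0 : (v *m v^T) 0 0 + qform A v^T = 0.
  have := congr1 (fun M => (M *m v^T) 0 0) vA.
  by rewrite /qform trmxK mulmxDr mulmx1 mulmxDl mul0mx !mxE.
have vv : 0 <= (v *m v^T) 0 0.
  have [_ /(_ v^T)] := psdmx1 n; by rewrite /qform mulmx1 trmxK.
have /eqP : (v *m v^T) 0 0 = 0.
  by apply/eqP; rewrite eq_le vv andbT -q0 lerDl pA.
rewrite mxE psumr_eq0 => [/allP h|i _]; last by rewrite mxE -expr2 sqr_ge0.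
apply/rowP => i; have := h i (mem_index_enum _).
by rewrite /= !mxE mulf_eq0 orbb => /eqP.
Qed.

(** The inverse is a congruence of A: A^-1 = A^-1 A A^-1. *)
Lemma psdmx_inv n (A : 'M[R]_n) : A \in unitmx -> psdmx A -> psdmx (invmx A).
Proof.
move=> uA pA; have [sA _] := pA.
have := psdmx_congr (invmx A) pA.
by rewrite trmx_inv sA mulVmx // mul1mx.
Qed.

End PositiveSemidefinite.

(** * The marginal kernel *)

Section Kernel.
Variables (R : realType) (n p : nat) (L : 'M[R]_n) (V Q : 'M[R]_(n, p)).
Hypothesis sL : L^T = L.
Hypothesis cL : cond_psdmx L V.
Hypothesis QV : orthonormal_basis_of Q V.

Local Notation Lt := (projected_kernel L Q).
Local Notation Pi := (1%:M - Q *m Q^T).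
Local Notation W := (invmx (1%:M + Lt)).
Local Notation K := (Q *m Q^T + Lt *m W).

Lemma trQ_mul_proj : Q^T *m Pi = 0.
Proof. by case: QV => QQ _; rewrite mulmxBr mulmx1 mulmxA QQ mul1mx subrr. Qed.

Lemma proj_mulQ : Pi *m Q = 0.
Proof. by case: QV => QQ _; rewrite mulmxBl mul1mx -mulmxA QQ mulmx1 subrr. Qed.

Lemma tr_proj : Pi^T = Pi.
Proof. by rewrite linearB /= trmx1 trmx_mul trmxK. Qed.

Lemma trV_mul_eq0 m (M : 'M[R]_(n, m)) : Q^T *m M = 0 -> V^T *m M = 0.
Proof.
by case: QV => _ /andP[_ /submxP[B ->]] QM; rewrite -mulmxA QM mulmx0.
Qed.

Lemma projected_kernel_mulQ : Lt *m Q = 0.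
Proof. by rewrite /projected_kernel -!mulmxA proj_mulQ !mulmx0. Qed.

Lemma trQ_mul_projected_kernel : Q^T *m Lt = 0.
Proof. by rewrite /projected_kernel !mulmxA trQ_mul_proj !mul0mx. Qed.

(** The projection Pi sends every vector to the kernel of V^T, where L is
    nonnegative. *)
Lemma psdmx_projected_kernel : psdmx Lt.
Proof.
split=> [|x].
  by rewrite /projected_kernel !trmx_mul tr_proj sL mulmxA.
have : 0 <= qform L (Pi *m x).
  by apply: cL; rewrite mulmxA trV_mul_eq0 ?mul0mx ?trQ_mul_proj.
by rewrite /qform trmx_mul tr_proj /projected_kernel !mulmxA.
Qed.

Lemma projected_kernel_unit : 1%:M + Lt \in unitmx.
Proof. exact: psdmx_unit1D psdmx_projected_kernel. Qed.

Lemma resolvent_mulQ : W *m Q = Q.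
Proof.
apply: (canLR (mulKmx projected_kernel_unit)).
by rewrite mulmxDl mul1mx projected_kernel_mulQ addr0.
Qed.

Lemma trQ_mul_resolvent : Q^T *m W = Q^T.
Proof.
apply: (canLR (mulmxK projected_kernel_unit)).
by rewrite mulmxDr mulmx1 trQ_mul_projected_kernel addr0.
Qed.

Lemma sub1_kernelE : 1%:M - K = W - Q *m Q^T.
Proof.
have e : W + Lt *m W = 1%:M.
  by rewrite -[X in X + _]mul1mx -mulmxDl mulmxV ?projected_kernel_unit.
by rewrite -[X in X - _]e opprD addrA addrAC addrK.
Qed.

Lemma trQ_mul_sub1_kernel : Q^T *m (1%:M - K) = 0.
Proof.
case: QV => QQ _.
by rewrite sub1_kernelE mulmxBr mulmxA QQ mul1mx trQ_mul_resolvent subrr.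
Qed.

(** With G = 1 - K, it suffices that Pi kills 1 - (1 + L) G, for then this
    matrix equals Q Q^T (1 - (1 + L) G), whose columns lie in the span of V.
    As Pi G = G, one has Pi (1 + L) G = (1 + Lt) G = Pi. *)
Lemma bordered_sub1_kernel :
  exists H, (1%:M + L) *m (1%:M - K) + V *m H = 1%:M.
Proof.
have [C QC] : exists C, Q = V *m C.
  case: QV => _ /andP[/submxP[C QC] _]; exists C^T.
  by rewrite -[Q]trmxK QC trmx_mul trmxK.
set G := 1%:M - K.
have PiG : Pi *m G = G.
  by rewrite mulmxBl mul1mx -mulmxA trQ_mul_sub1_kernel mulmx0 subr0.
have LtG : (1%:M + Lt) *m G = Pi.
  rewrite /G sub1_kernelE mulmxBr mulmxV ?projected_kernel_unit // mulmxA.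
  by rewrite mulmxDl mul1mx projected_kernel_mulQ addr0.
have PiLG : Pi *m ((1%:M + L) *m G) = Pi.
  rewrite -[RHS]LtG [(_ + L) *m G]mulmxDl [(_ + Lt) *m G]mulmxDl !mul1mx.
  by rewrite mulmxDr PiG /projected_kernel -!mulmxA PiG.
exists (C *m (Q^T *m (1%:M - (1%:M + L) *m G))).
rewrite mulmxA -QC mulmxA -[Q *m Q^T](subKr 1%:M).
by rewrite mulmxBl mul1mx [Pi *m _]mulmxBr PiLG mulmx1 subrr subr0 addrC subrK.
Qed.

(** With W = (1 + Lt)^-1, both bounds come from the congruences
    Lt W = W^T (Lt + Lt^T Lt) W and 1 - K = Pi^T W Pi. *)
Lemma marginal_kernel_projected : marginal_kernel K.
Proof.
have pLt := psdmx_projected_kernel; have [sLt _] := pLt.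
have pW : psdmx W.
  apply: psdmx_inv projected_kernel_unit _.
  exact: psdmxD (psdmx1 _ _) pLt.
have [sW _] := pW.
have pK : psdmx K.
  apply: psdmxD; first by rewrite -{1}[Q]trmxK; exact: psdmx_gram.
  have -> : Lt *m W = W^T *m (Lt + Lt^T *m Lt) *m W.
    have -> : Lt + Lt^T *m Lt = (1%:M + Lt) *m Lt.
      by rewrite sLt mulmxDl mul1mx.
    by rewrite sW mulKmx // projected_kernel_unit.
  by apply: psdmx_congr; apply: psdmxD => //; exact: psdmx_gram.
split; [by case: pK | by rewrite /loewner_le subr0 |].
rewrite /loewner_le.
have -> : 1%:M - K = Pi^T *m W *m Pi.
  rewrite tr_proj [Pi *m W]mulmxBl mul1mx -(mulmxA Q) trQ_mul_resolvent.
  rewrite mulmxBl -[Q *m Q^T *m _]mulmxA trQ_mul_proj mulmx0 subr0.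
  by rewrite mulmxBr mulmx1 mulmxA resolvent_mulQ sub1_kernelE.
exact: psdmx_congr.
Qed.

End Kernel.

(** * Extended L-ensembles are determinantal *)

Section RandomSubset.
Context {R : realType} {d : measure_display} {T : measurableType d}.

Lemma probability_superset (P : probability T R) n (X : T -> {set 'I_n})
    (A : {set 'I_n}) :
  random_subset X ->
  P [set w | A \subset X w] =
  (\sum_(S : {set 'I_n} | A \subset S) P [set w | X w = S])%E.
Proof.
move=> mX.
have -> : [set w | A \subset X w] =
    \bigcup_(S in [set S : {set 'I_n} | A \subset S]) [set w | X w = S].
  apply/seteqP; split=> w /=; first by move=> AX; exists (X w).
  by case=> S /= AS ->.
rewrite measure_fin_bigcup; last 3 first.
- exact: finite_finset.
- by move=> S S' _ _ [w [/= <- <-]].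
- by move=> S _; exact: mX.
rewrite (fsbigE [seq S : {set 'I_n} <- index_enum _ | A \subset S]) /=.
- by rewrite big_filter_cond; apply: eq_bigl => S; rewrite mem_setE andbb.
- exact: filter_uniq (index_enum_uniq _).
- by move=> S /=; rewrite mem_filter => /andP[].
- by move=> S /= AS; rewrite mem_filter AS mem_index_enum.
Qed.

End RandomSubset.

Theorem theorem2p9 (R : realType) (d : measure_display) (T : measurableType d)
    (P : probability T R) (n p : nat) (L : 'M[R]_n) (V Q : 'M[R]_(n, p))
    (X : T -> {set 'I_n}) :
  nonnegative_pair L V ->
  is_extended_L_ensemble P X L V ->
  orthonormal_basis_of Q V ->
  let Lt := projected_kernel L Q in
  (1%:M + Lt) \in unitmx /\
  is_dpp P X (Q *m Q^T + Lt *m invmx (1%:M + Lt)).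
Proof.
move=> [_ sL _ cL] [mX [c Pc]] QV Lt.
split; first exact: projected_kernel_unit sL cL QV.
have mK := marginal_kernel_projected sL cL QV; rewrite -/Lt in mK.
split=> // A.
set K := Q *m Q^T + _.
pose D (B : {set 'I_n}) := \det (block_mx (L + ind_mx (~: B)) V V^T 0).
have PD (B : {set 'I_n}) :
    P [set w | B \subset X w] = (c * ((-1) ^+ p * D B))%:E.
  rewrite probability_superset //; under eq_bigr => S _ do rewrite Pc.
  by rewrite sumEFin -!mulr_sumr sum_det_bordered_submx.
(* The total mass fixes the proportionality constant. *)
have P1 : c * ((-1) ^+ p * \det (block_mx (L + 1%:M) V V^T 0)) = 1.
  have E : [set w | finset.set0 \subset X w] = [set: T].
    by apply/seteqP; split=> // w _ /=; rewrite finset.sub0set.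
  have := PD finset.set0; rewrite E probability_setT /D ind_mxC.
  have -> : ind_mx finset.set0 = 0 :> 'M[R]_n.
    by apply/matrixP => i j; rewrite ind_mxE inE mxE.
  by rewrite subr0 => -[].
have VG := trV_mul_eq0 QV (trQ_mul_sub1_kernel sL cL QV).
have [H GH] := bordered_sub1_kernel sL cL QV.
rewrite PD /D (det_bordered_kernel A VG GH) -/Lt -/K subKr.
by rewrite [X in c * X]mulrA mulrA P1 mul1r.
Qed.
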